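(* Let $\mathbb{H}$ be the skew field of quaternions and let $h\mapsto \hat h$ be an involutive automorphism of $\mathbb{H}$ (possibly the identity). Let $A\in\mathbb{H}^{m\times m}$, $B\in\mathbb{H}^{n\times n}$ and $C\in\mathbb{H}^{m\times n}$. Then the matrix equation $$AX-\widehat{X}B=C$$ has a solution $X\in\mathbb{H}^{m\times n}$ if and only if there exists a nonsingular matrix $S\in\mathbb{H}^{(m+n)\times(m+n)}$ such that $$\widehat{S}^{-1}\begin{bmatrix} A & C\\ 0 & B\end{bmatrix}S=\begin{bmatrix} A & 0\\ 0 & B\end{bmatrix}.$$
   Context: $\mathbb{H}$ denotes the skew field of (real Hamilton) quaternions. An involutive automorphism of $\mathbb{H}$ is a bijection $\mathbb{H}\to\mathbb{H}$, $h\mapsto\hat h$ (possibly the identity), such that $\widehat{h+k}=\hat h+\hat k$, $\widehat{hk}=\hat h\,\hat k$ and $\hat{\hat h}=h$ for all $h,k\in\mathbb{H}$. For a quaternion matrix $H=[h_{ij}]$, $\widehat{H}:=[\hat h_{ij}]$ is obtained by applying the automorphism entrywise. $\mathbb{H}^{m\times n}$ is the set of $m\times n$ matrices over $\mathbb{H}$. *)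

(* Defs.v *)
From HB Require Import structures.
From mathcomp Require Import all_boot all_order all_algebra.
From mathcomp Require Import reals.
From mathcomp Require Import ring lra.

Set Implicit Arguments.
Unset Strict Implicit.
Unset Printing Implicit Defensive.

Import Order.TTheory GRing.Theory Num.Theory.
Local Open Scope ring_scope.

(* [Quaternion a b c d] stands for a + b i + c j + d k. *)
Record quaternion (R : Type) := Quaternion {
  qre : R; qi : R; qj : R; qk : R }.

Definition tuple_of_quaternion R (x : quaternion R) : R * R * R * R :=
  (qre x, qi x, qj x, qk x).

Definition quaternion_of_tuple R (u : R * R * R * R) : quaternion R :=
  let: (a, b, c, d) := u in Quaternion a b c d.

Lemma tuple_of_quaternionK R :
  cancel (@tuple_of_quaternion R) (@quaternion_of_tuple R).
Proof. by case. Qed.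

HB.instance Definition _ (R : choiceType) :=
  Choice.copy (quaternion R) (can_type (@tuple_of_quaternionK R)).

Section QuaternionRing.
Variable R : realType.
Implicit Types x y z : quaternion R.

Definition addq x y : quaternion R :=
  Quaternion (qre x + qre y) (qi x + qi y) (qj x + qj y) (qk x + qk y).

Definition oppq x : quaternion R :=
  Quaternion (- qre x) (- qi x) (- qj x) (- qk x).

Definition zeroq : quaternion R := Quaternion 0 0 0 0.

(* The product determined by i^2 = j^2 = k^2 = ijk = -1, with R central. *)
Definition mulq x y : quaternion R :=
  Quaternion
    (qre x * qre y - qi x * qi y - qj x * qj y - qk x * qk y)
    (qre x * qi y + qi x * qre y + qj x * qk y - qk x * qj y)
    (qre x * qj y - qi x * qk y + qj x * qre y + qk x * qi y)
    (qre x * qk y + qi x * qj y - qj x * qi y + qk x * qre y).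

Definition oneq : quaternion R := Quaternion 1 0 0 0.

Fact addqA : associative addq.
Proof. by move=> x y z; congr Quaternion; rewrite /= addrA. Qed.

Fact addqC : commutative addq.
Proof. by move=> x y; congr Quaternion; rewrite /= addrC. Qed.

Fact add0q : left_id zeroq addq.
Proof. by case=> a b c d; rewrite /addq /= !add0r. Qed.

Fact addNq : left_inverse zeroq oppq addq.
Proof. by move=> x; rewrite /addq /= !addNr. Qed.

HB.instance Definition _ :=
  GRing.isZmodule.Build (quaternion R) addqA addqC add0q addNq.

Fact mulqA : associative mulq.
Proof. by move=> x y z; congr Quaternion => /=; ring. Qed.

Fact mul1q : left_id oneq mulq.
Proof. by case=> a b c d; congr Quaternion => /=; ring. Qed.

Fact mulq1 : right_id oneq mulq.
Proof. by case=> a b c d; congr Quaternion => /=; ring. Qed.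

Fact mulqDl : left_distributive mulq +%R.
Proof. by move=> x y z; congr Quaternion => /=; ring. Qed.

Fact mulqDr : right_distributive mulq +%R.
Proof. by move=> x y z; congr Quaternion => /=; ring. Qed.

Fact oneq_neq0 : oneq != 0.
Proof. by apply/eqP => -[] /eqP; rewrite oner_eq0. Qed.

HB.instance Definition _ := GRing.Zmodule_isNzRing.Build (quaternion R)
  mulqA mul1q mulq1 mulqDl mulqDr oneq_neq0.

Definition sqnormq x : R := qre x ^+ 2 + qi x ^+ 2 + qj x ^+ 2 + qk x ^+ 2.

Lemma sqnormq_eq0 x : (sqnormq x == 0) = (x == 0).
Proof.
apply/idP/eqP => [|->]; last by rewrite /sqnormq /= !expr0n /= !addr0.
rewrite /sqnormq !paddr_eq0 ?addr_ge0 ?sqr_ge0 // !sqrf_eq0.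
by case: x => a b c d /= /andP[/andP[/andP[/eqP-> /eqP->] /eqP->] /eqP->].
Qed.

Definition invq x : quaternion R :=
  Quaternion (qre x / sqnormq x) (- qi x / sqnormq x)
             (- qj x / sqnormq x) (- qk x / sqnormq x).

Fact mulVq : {in [pred x : quaternion R | x != 0], left_inverse 1 invq *%R}.
Proof.
move=> x; rewrite inE -sqnormq_eq0 => x0.
by congr Quaternion => /=; move: x0; rewrite /sqnormq => x0; field.
Qed.

Fact mulqV : {in [pred x : quaternion R | x != 0], right_inverse 1 invq *%R}.
Proof.
move=> x; rewrite inE -sqnormq_eq0 => x0.
by congr Quaternion => /=; move: x0; rewrite /sqnormq => x0; field.
Qed.

Fact unitqP x y : y * x = 1 /\ x * y = 1 -> [pred x | x != 0] x.
Proof.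
case=> yx1 _ /=; apply/eqP => x0; move: yx1.
by rewrite x0 mulr0 => /esym/eqP; rewrite oner_eq0.
Qed.

Fact invq_out : {in [predC [pred x : quaternion R | x != 0]], invq =1 id}.
Proof.
move=> x; rewrite !inE negbK => /eqP->.
by congr Quaternion; rewrite /= ?oppr0 mul0r.
Qed.

HB.instance Definition _ := GRing.NzRing_hasMulInverse.Build (quaternion R)
  mulVq mulqV unitqP invq_out.

End QuaternionRing.

Definition involutive_automorphism (H : pzRingType) (f : H -> H) : Prop :=
  [/\ bijective f, {morph f : h k / h + k}, {morph f : h k / h * k}
    & involutive f].

(* The library's [unitmx] and [invmx] require commutative coefficients, so
   inverses of square matrices over a skew field are introduced here. *)
Definition is_inverse_mx (H : pzRingType) (n : nat) (S T : 'M[H]_n) : Prop :=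
  S *m T = 1%:M /\ T *m S = 1%:M.

Definition nonsingular_mx (H : pzRingType) (n : nat) (S : 'M[H]_n) : Prop :=
  exists T : 'M[H]_n, is_inverse_mx S T.

(* Main.v *)
(** If [M S = hat S D] with [S] nonsingular, where [M] and [D] are the block
    triangular and block diagonal matrices, then [Z |-> S Z] embeds the space
    of solutions [Z = (Q; V)] of [D Z = hat Z B] into that of [M Z = hat Z B]
    (the dimension-count argument of Flanders and Wimmer for Roth's theorem).
    Both are finite-dimensional real spaces, because [hat] fixes the center.
    The projections [Z |-> V] have the same kernel on both spaces, and the
    image for [M] lies in the image for [D], so the two images coincide. Since
    [(0; 1)] solves the second system, some [(Q; 1)] solves the first one, and
    [X = - Q] is the required solution. *)

From HB Require Import structures.
Require Import Defs.
From mathcomp Require Import all_boot all_order all_algebra.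
From mathcomp Require Import reals.
From mathcomp Require Import ring lra.
Import GRing.Theory.
Import Order.TTheory Num.Theory VectorInternalTheory.
Local Open Scope ring_scope.

(** By rank-nullity, [\dim K = \dim (K :&: lker p) + \dim (p @: K)]. The larger space [K2] has no
    larger kernel part, so its image is at least as large as that of [K1]. *)
Lemma dim_limg_eq (F : fieldType) (vT wT : vectType F) (K1 K2 : {vspace vT})
    (p : 'Hom(vT, wT)) :
  (\dim K1 <= \dim K2)%N -> (K2 :&: lker p <= K1)%VS ->
  (p @: K2 <= p @: K1)%VS -> (p @: K2 = p @: K1)%VS.
Proof.
move=> dimK kerK imK; apply/eqP; rewrite eqEdim imK /=.
have kerK' : (\dim (K2 :&: lker p) <= \dim (K1 :&: lker p))%N.
  by apply: dimvS; rewrite subv_cap kerK capvSr.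
move: dimK; rewrite -(limg_ker_dim p K1) -(limg_ker_dim p K2) => dimK.
by rewrite -(leq_add2l (\dim (K1 :&: lker p))) (leq_trans dimK) ?leq_add2r.
Qed.

Section RealQuaternions.
Set Implicit Arguments.
Unset Strict Implicit.
Unset Printing Implicit Defensive.
Variable R : realType.
Implicit Types (a b : R) (x y : quaternion R).

Definition realq a : quaternion R := Quaternion a 0 0 0.

Lemma realq_is_zmod_morphism : zmod_morphism realq.
Proof. by move=> a b; congr Quaternion; rewrite /= oppr0 addr0. Qed.

Lemma realq_is_monoid_morphism : monoid_morphism realq.
Proof. by split=> // a b; congr Quaternion => /=; ring. Qed.

HB.instance Definition _ :=
  GRing.isZmodMorphism.Build R (quaternion R) realq realq_is_zmod_morphism.
HB.instance Definition _ :=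
  GRing.isMonoidMorphism.Build R (quaternion R) realq realq_is_monoid_morphism.

Lemma realqM a x :
  realq a * x = Quaternion (a * qre x) (a * qi x) (a * qj x) (a * qk x).
Proof. by congr Quaternion => /=; ring. Qed.

Lemma realqC a x : realq a * x = x * realq a.
Proof. by congr Quaternion => /=; ring. Qed.

(** Commuting with the unit j kills the i and k coordinates, and commuting with i kills the j
    coordinate. *)
Lemma center_realq x : (forall y, x * y = y * x) -> x = realq (qre x).
Proof.
case: x => a b c d xC.
have [_ h1 _ h2] := xC (Quaternion 0 0 1 0).
have [_ _ h3 h4] := xC (Quaternion 0 1 0 0); rewrite /realq /=.
by congr Quaternion; lra.
Qed.

Variable hat : {rmorphism quaternion R -> quaternion R}.
Hypothesis hatK : involutive hat.

(** The center is preserved, so [hat] induces an involutive ring endomorphism [f] of the reals. It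
    maps squares to squares, hence is monotone, and a monotone involution of a total order is the
    identity. *)
Lemma hat_realq a : hat (realq a) = realq a.
Proof.
pose f b := qre (hat (realq b)).
have fE b : hat (realq b) = realq (f b).
  by apply: center_realq => y; rewrite -[y]hatK -!rmorphM realqC.
have fK b : f (f b) = b by rewrite /f -fE hatK.
have fB b c : f (b - c) = f b - f c by rewrite /f !rmorphB.
have f_ge0 b : 0 <= b -> 0 <= f b.
  move=> b0; rewrite -[b]sqr_sqrtr // expr2 /f !rmorphM !fE -rmorphM /=.
  by rewrite -expr2 sqr_ge0.
have f_le b c : b <= c -> f b <= f c.
  by rewrite -subr_ge0 => /f_ge0; rewrite fB subr_ge0.
(* Applying [f] to [a <= f a] gives [f a <= a], and symmetrically. *)
rewrite fE; congr realq; apply/le_anti.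
by case/orP: (le_total a (f a)) => h; rewrite h ?andbT /=;
  have := f_le _ _ h; rewrite fK.
Qed.

(* Matrices over the quaternions carry a canonical left module structure over
   the quaternions themselves; this alias carries the one over the reals. *)
Definition real_mx (m n : nat) := 'M[quaternion R]_(m, n).

HB.instance Definition _ m n := GRing.Zmodule.on (real_mx m n).

Section RealMx.
Variables m n : nat.

Definition scale_real_mx a (Z : real_mx m n) : real_mx m n :=
  realq a *: (Z : 'M[quaternion R]_(m, n)).

Fact scale_real_mxA a b Z :
  scale_real_mx a (scale_real_mx b Z) = scale_real_mx (a * b) Z.
Proof. by rewrite /scale_real_mx scalerA rmorphM. Qed.

Fact scale_real_mx1 : left_id 1 scale_real_mx.
Proof. by move=> Z; rewrite /scale_real_mx rmorph1 scale1r. Qed.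

Fact scale_real_mxDr : right_distributive scale_real_mx +%R.
Proof. by move=> a Y Z; rewrite /scale_real_mx scalerDr. Qed.

Fact scale_real_mxDl Z : {morph scale_real_mx^~ Z : a b / a + b}.
Proof. by move=> a b; rewrite /scale_real_mx rmorphD scalerDl. Qed.

HB.instance Definition _ := GRing.Zmodule_isLmodule.Build R (real_mx m n)
  scale_real_mxA scale_real_mx1 scale_real_mxDr scale_real_mxDl.

Lemma scale_real_mxE a (Z : real_mx m n) :
  a *: Z = realq a *: (Z : 'M[quaternion R]_(m, n)).
Proof. by []. Qed.

Definition real_mx_coords (Z : real_mx m n) :
    'M[R]_(m, n) * 'M[R]_(m, n) * 'M[R]_(m, n) * 'M[R]_(m, n) :=
  (map_mx (@qre R) Z, map_mx (@qi R) Z, map_mx (@qj R) Z, map_mx (@qk R) Z).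

Lemma real_mx_coords_is_linear : linear real_mx_coords.
Proof.
move=> a Y Z; rewrite /real_mx_coords scale_real_mxE.
by congr (_, _, _, _); apply/matrixP => i j; rewrite !mxE realqM.
Qed.

Definition real_mx_of_coords
    (u : 'M[R]_(m, n) * 'M[R]_(m, n) * 'M[R]_(m, n) * 'M[R]_(m, n)) :
    real_mx m n :=
  let: (a, b, c, d) := u in
  \matrix_(i, j) Quaternion (a i j) (b i j) (c i j) (d i j).

Lemma real_mx_coordsK : cancel real_mx_coords real_mx_of_coords.
Proof. by move=> Z; apply/matrixP => i j; rewrite !mxE; case: (Z i j). Qed.

Lemma real_mx_of_coordsK : cancel real_mx_of_coords real_mx_coords.
Proof.
by case=> [[[a b] c] d]; congr (_, _, _, _); apply/matrixP => i j; rewrite !mxE.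
Qed.

Fact real_mx_vect_axiom :
  Vector.axiom
    (dim ('M[R]_(m, n) * 'M[R]_(m, n) * 'M[R]_(m, n) * 'M[R]_(m, n))%type)
    (real_mx m n).
Proof.
exists (fun Z => v2r (real_mx_coords Z)).
  by move=> a Y Z; rewrite real_mx_coords_is_linear linearP.
exists (fun u => real_mx_of_coords (r2v u)) => u.
  by rewrite v2rK real_mx_coordsK.
by rewrite real_mx_of_coordsK r2vK.
Qed.

HB.instance Definition _ :=
  Lmodule_hasFinDim.Build R (real_mx m n) real_mx_vect_axiom.

End RealMx.

(** Left scaling commutes with left multiplication by [M] because real scalars are central; general
    quaternion scalars would fail here. *)
Lemma mulmx_realr m n p a (M : 'M[quaternion R]_(m, n)) (Z : 'M_(n, p)) :
  M *m (realq a *: Z) = realq a *: (M *m Z).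
Proof.
apply/matrixP => i j; rewrite !mxE big_distrr /=; apply: eq_bigr => k _.
by rewrite !mxE !mulrA realqC.
Qed.

Lemma map_hatZ m n a (Z : 'M[quaternion R]_(m, n)) :
  map_mx hat (realq a *: Z) = realq a *: map_mx hat Z.
Proof. by apply/matrixP => i j; rewrite !mxE rmorphM /= hat_realq. Qed.

Definition lmul_mx m n p (M : 'M[quaternion R]_(m, n)) (Z : real_mx n p) :
  real_mx m p := M *m (Z : 'M_(n, p)).

Lemma lmul_mx_is_linear m n p (M : 'M_(m, n)) : linear (@lmul_mx m n p M).
Proof. by move=> a Y Z; rewrite /lmul_mx mulmxDr mulmx_realr. Qed.

HB.instance Definition _ m n p M := GRing.isLinear.Build R (real_mx n p)
  (real_mx m p) *:%R (@lmul_mx m n p M) (@lmul_mx_is_linear m n p M).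

(** The kernel is the solution space of [M Z = hat Z B]. *)
Definition sylvester m n (M : 'M[quaternion R]_m) (B : 'M[quaternion R]_n)
    (Z : real_mx m n) : real_mx m n :=
  M *m (Z : 'M_(m, n)) - map_mx hat Z *m B.

Lemma sylvester_is_linear m n M B : linear (@sylvester m n M B).
Proof.
move=> a Y Z; rewrite /sylvester map_mxD map_hatZ !mulmxDr mulmxDl mulmx_realr.
by rewrite -scalemxAl scalerBr opprD addrACA.
Qed.

HB.instance Definition _ m n M B := GRing.isLinear.Build R (real_mx m n)
  (real_mx m n) *:%R (@sylvester m n M B) (@sylvester_is_linear m n M B).

Definition lower_mx m n p (Z : real_mx (m + n) p) : real_mx n p :=
  dsubmx (Z : 'M_(m + n, p)).

Lemma lower_mx_is_linear m n p : linear (@lower_mx m n p).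
Proof. by move=> a Y Z; apply/matrixP => i j; rewrite !mxE. Qed.

HB.instance Definition _ m n p := GRing.isLinear.Build R (real_mx (m + n) p)
  (real_mx n p) *:%R (@lower_mx m n p) (@lower_mx_is_linear m n p).

Lemma sylvester_block m n (A : 'M[quaternion R]_m) (B : 'M[quaternion R]_n) C
    (Q : 'M_(m, n)) (V : 'M_n) :
  sylvester (block_mx A C 0 B) B (col_mx Q V) =
    col_mx (A *m Q + C *m V - map_mx hat Q *m B) (B *m V - map_mx hat V *m B).
Proof.
by rewrite /sylvester mul_block_col map_col_mx mul_col_mx mul0mx add0r
  opp_col_mx add_col_mx.
Qed.

Lemma col_mx_eq0P m n p (Q : 'M[quaternion R]_(m, p)) (V : 'M_(n, p)) :
  col_mx Q V = 0 <-> Q = 0 /\ V = 0.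
Proof.
rewrite -[0](@col_mx0 _ m n p).
by split=> [/eq_col_mx //|[-> ->]].
Qed.

Lemma solution_of_similarity m n (A : 'M[quaternion R]_m)
    (B : 'M[quaternion R]_n) (C : 'M[quaternion R]_(m, n))
    (S S' : 'M[quaternion R]_(m + n)) :
  S' *m S = 1%:M ->
  block_mx A C 0 B *m S = map_mx hat S *m block_mx A 0 0 B ->
  exists X : 'M[quaternion R]_(m, n), A *m X - map_mx hat X *m B = C.
Proof.
set M := block_mx A C 0 B; set D := block_mx A 0 0 B => S'S MS.
pose K (N : 'M[quaternion R]_(m + n)) : {vspace real_mx (m + n) n} :=
  lker (linfun (sylvester N B)).
have KE N Z : (Z \in K N) = (sylvester N B Z == 0) by rewrite memv_ker lfunE.
pose p := linfun (@lower_mx m n n).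
pose g := linfun (@lmul_mx (m + n) (m + n) n S).
have imK : (p @: K M = p @: K D)%VS.
  apply: dim_limg_eq.
  (* Left multiplication by [S] is injective and maps [K D] into [K M]: [M S Z = hat S D Z = hat S
     hat Z B = hat (S Z) B]. *)
  - have kg : lker g == 0%VS.
      apply/lker0P => Y Z; rewrite !lfunE /= /lmul_mx => /(congr1 (mulmx S')).
      by rewrite !mulmxA S'S !mul1mx.
    rewrite -(limg_dim_eq (f := g) (U := K D)); last by rewrite (eqP kg) capv0.
    apply/dimvS/subvP => _ /memv_imgP[Z + ->]; rewrite !KE lfunE /=.
    rewrite /sylvester /lmul_mx subr_eq0 => /eqP DZ.
    by rewrite mulmxA MS map_mxM -!mulmxA DZ subrr.
  (* The block [C] only acts on [V], so the two systems agree when [V = 0]. *)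
  - apply/subvP => Z; rewrite memv_cap KE memv_ker lfunE /= KE.
    case/andP=> + /eqP; rewrite -[Z]vsubmxK /lower_mx col_mxKd => + V0.
    by rewrite V0 !sylvester_block !mulmx0.
  (* The lower equation [B V = hat V B] is common to both systems, so [(0; V)] lies in [K D]. *)
  apply/subvP => _ /memv_imgP[Z ZK ->]; move: ZK.
  rewrite KE -[Z]vsubmxK sylvester_block => /eqP/col_mx_eq0P[_ V0].
  apply/memv_imgP; exists (col_mx 0 (dsubmx Z)).
    rewrite KE sylvester_block; apply/eqP/col_mx_eq0P; split => //.
    by rewrite map_mx0 !(mulmx0, mul0mx) subr0 addr0.
  by rewrite !lfunE /= /lower_mx !col_mxKd.
have : (1%:M : real_mx n n) \in (p @: K M)%VS.
  rewrite imK; apply/memv_imgP; exists (col_mx 0 1%:M).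
    rewrite KE sylvester_block; apply/eqP/col_mx_eq0P; split.
      by rewrite map_mx0 !(mulmx0, mul0mx) subr0 addr0.
    by rewrite map_mx1 mulmx1 mul1mx subrr.
  by rewrite lfunE /= /lower_mx col_mxKd.
case/memv_imgP=> Z ZK; rewrite lfunE /= /lower_mx => V1; move: ZK.
rewrite KE -[Z]vsubmxK -V1 sylvester_block => /eqP/col_mx_eq0P[/eqP QE _].
exists (- usubmx Z); move: QE; rewrite mulmx1 map_mxN mulmxN mulNmx opprK.
by rewrite addrAC addr_eq0 => /eqP h; rewrite addrC -opprB h opprK.
Qed.

End RealQuaternions.

(** The unipotent matrices [U Y] turn addition into multiplication. With [S = U (- X)] and
    [T = U (hat X)], the upper right block of the product is [C - A X + hat X B = 0]. *)
Lemma similarity_of_solution (H : pzRingType) (hat : {rmorphism H -> H})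
    (m n : nat) (A : 'M[H]_m) (B : 'M[H]_n) (C X : 'M[H]_(m, n)) :
  A *m X - map_mx hat X *m B = C ->
  exists S : 'M[H]_(m + n),
     nonsingular_mx S /\
     exists2 T : 'M[H]_(m + n),
       is_inverse_mx (map_mx hat S) T &
       T *m block_mx A C 0 B *m S = block_mx A 0 0 B.
Proof.
move=> XC; pose U (Y : 'M[H]_(m, n)) : 'M_(m + n) := block_mx 1%:M Y 0 1%:M.
have UM Y Z : U Y *m U Z = U (Y + Z).
  rewrite /U mulmx_block.
  by rewrite !(mulmx0, mul0mx, mulmx1, mul1mx, addr0, add0r) addrC.
have U0 : U 0 = 1%:M by rewrite /U -scalar_mx_block.
have UV Y : is_inverse_mx (U (- Y)) (U Y) by split; rewrite UM ?addNr ?subrr U0.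
exists (U (- X)); split; first by exists (U X).
exists (U (map_mx hat X)).
  by rewrite /U map_block_mx !map_mx1 map_mx0 map_mxN; apply: UV.
rewrite /U !mulmx_block !(mulmx0, mul0mx, mulmx1, mul1mx, addr0, add0r) -XC.
by rewrite mulmxN subrK addNr.
Qed.

Theorem theorem1 (R : realType) (hat : quaternion R -> quaternion R)
  (hat_inv : involutive_automorphism hat) (m n : nat)
  (A : 'M[quaternion R]_m) (B : 'M[quaternion R]_n)
  (C : 'M[quaternion R]_(m, n)) :
  (exists X : 'M[quaternion R]_(m, n), A *m X - map_mx hat X *m B = C)
  <->
  (exists S : 'M[quaternion R]_(m + n),
     nonsingular_mx S /\
     exists2 T : 'M[quaternion R]_(m + n),
       is_inverse_mx (map_mx hat S) T &
       T *m block_mx A C 0 B *m S = block_mx A 0 0 B).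
Proof.
case: hat_inv => _ hatD hatM hatK.
have hatB : zmod_morphism hat.
  by move=> x y; apply/eqP; rewrite eq_sym subr_eq -hatD subrK.
(* Unit preservation comes from the involution: [hat 1 = hat 1 * hat (hat 1) = hat (1 * hat 1) =
   1]. *)
have hat1 : hat 1 = 1 by rewrite -[LHS]mulr1 -{2}[1]hatK -hatM mul1r hatK.
pose hatZ := GRing.isZmodMorphism.Build _ _ hat hatB.
pose hatMM := GRing.isMonoidMorphism.Build _ _ hat (conj hat1 hatM).
pose hatR : {rmorphism quaternion R -> quaternion R} := HB.pack hat hatZ hatMM.
split=> [[X XC]|[S [[S' [_ S'S]] [T [ST _] TMS]]]].
  exact: (@similarity_of_solution _ hatR _ _ _ _ _ X).
apply: (@solution_of_similarity _ hatR hatK _ _ _ _ _ S S' S'S).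
(* Multiplying the similarity on the left by [hat S] cancels [T]. *)
by rewrite -TMS -[T *m _ *m _]mulmxA [RHS]mulmxA ST mul1mx.
Qed.
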